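(* Let $p\equiv 1 \pmod 4$ be prime. For the canonical choice of eigenfunctions $\phi_k$, $k=0,1,\dots,p-1$, of the Paley graph over $\mathbb{F}_p$, with associated eigenvalues $\lambda_k$, the function $$ x\mapsto \sum_{k=0}^{p-1} \frac{1}{\sqrt{\lambda_k}} \frac{\phi_k(x)}{\|\phi_k\|_{L^{\infty}}}, \qquad x\in\mathbb{F}_p,$$ assumes exactly three different values, depending on whether $x=0$, $x$ is a quadratic residue, or $x$ is a quadratic non-residue in $\mathbb{F}_p$.
   Context: The Paley graph over $\mathbb{F}_p$ ($p\equiv 1$ mod $4$ prime) has vertex set $\mathbb{F}_p=\{0,1,\dots,p-1\}$, and two vertices $a,b$ are connected by an edge if and only if $a-b\equiv x^2$ has a solution with $0\neq x\in\mathbb{F}_p$. The canonical eigenfunctions are $\phi_k(x)=e^{2\pi i kx/p}$ for $k=0,1,\dots,p-1$, and $\|\phi_k\|_{L^\infty}=\max_{x\in\mathbb{F}_p}|\phi_k(x)|$. The eigenvalues are taken to be $(p-1)/2$ with multiplicity $1$ (for the constant function $\phi_0$), and $\lambda_-=(p-\sqrt p)/2$ and $\lambda_+=(p+\sqrt p)/2$, each with multiplicity $(p-1)/2$; for $k\neq 0$ the eigenvalue associated to $\phi_k$ is $\lambda_+$ if $k\equiv x^2 \pmod p$ has no solution, and $\lambda_-$ otherwise. The sum runs over all eigenvectors, and the phase of the complex values $\phi_k(x)$ is kept (no absolute values are taken). In the trichotomy, quadratic residue means nonzero quadratic residue. *)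

(* Defs.v *)
From mathcomp Require Import all_boot all_order all_algebra.
From mathcomp Require Import reals trigo complex.
Set Implicit Arguments.
Unset Strict Implicit.
Unset Printing Implicit Defensive.
Import Order.TTheory GRing.Theory Num.Theory.
Local Open Scope ring_scope.
Local Open Scope complex_scope.

(* Throughout, p is meant to be a prime with p = 1 mod 4. *)

Definition quad_res (p : nat) (a : 'F_p) : bool :=
  [exists x : 'F_p, (x != 0) && (a == x ^+ 2)].

Definition quad_nonres (p : nat) (a : 'F_p) : bool :=
  (a != 0) && ~~ quad_res a.

Definition paley_edge (p : nat) : rel 'F_p := fun a b => quad_res (a - b).

Definition paley_laplacian (R : realType) (p : nat) (f : 'F_p -> R[i])
    (a : 'F_p) : R[i] :=
  \sum_(b | paley_edge a b) (f a - f b).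

Definition expi (R : realType) (t : R) : R[i] := cos t +i* sin t.

(* In the product k * x the element x of 'F_p stands for its representative
   in {0, .., p - 1}. *)
Definition paley_phi (R : realType) (p k : nat) (x : 'F_p) : R[i] :=
  expi (2 * pi * (k * x)%N%:R / p%:R).

Definition sup_norm (R : realType) (p : nat) (f : 'F_p -> R[i]) : R :=
  \big[Num.max/0]_(x : 'F_p) ComplexField.Normc.normc (f x).

(* The eigenvalues (p -+ sqrt p) / 2 are those of the Laplacian; the Laplacian
   eigenvalue 0 of the constant function phi_0 is by convention replaced by the
   degree (p - 1) / 2 of the graph, so that 1 / sqrt(lambda_0) makes sense. *)
Definition paley_lambda (R : realType) (p k : nat) : R :=
  if k == 0%N then (p%:R - 1) / 2
  else if quad_res (k%:R : 'F_p) then (p%:R - Num.sqrt p%:R) / 2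
  else (p%:R + Num.sqrt p%:R) / 2.

Definition paley_sum (R : realType) (p : nat) (x : 'F_p) : R[i] :=
  \sum_(k < p)
    (Num.sqrt (paley_lambda R p k))^-1%:C
      * (paley_phi R k x / (sup_norm (@paley_phi R p k))%:C).

Lemma expiD (R : realType) (s t : R) : expi (s + t) = expi s * expi t.
Proof.
rewrite /expi cosD sinD; apply/eqP; rewrite eq_complex /=.
by rewrite eqxx [X in X == _]addrC eqxx.
Qed.

Lemma paley_phiD (R : realType) (p k : nat) (x y : 'F_p) : prime p ->
  paley_phi R k (x + y) = paley_phi R k x * paley_phi R k y.
Proof.
move=> p_pr; rewrite /paley_phi -expiD.
have pn0 : p%:R != 0 :> R by rewrite pnatr_eq0 -lt0n prime_gt0.
have expi2n n (t : R) : expi (t + 2 * pi * n%:R) = expi t.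
  elim: n => [|n IH]; first by rewrite mulr0 addr0.
  rewrite -[n.+1%:R]natr1 mulrDr mulr1 addrA expiD IH.
  rewrite /expi [2 * pi]mulrC mulr_natr -[pi *+ 2]add0r cosD2pi sinD2pi.
  by rewrite cos0 sin0; exact: mulr1.
have -> : ((x + y)%R : nat) = ((x + y) %% p)%N.
  by have /= := congr1 (modn (x + y)) (Fp_cast p_pr).
rewrite -mulrDl -mulrDr -natrD -mulnDr [in RHS](divn_eq (x + y) p).
set q := ((x + y) %/ p)%N; set r := ((x + y) %% p)%N.
have -> : 2 * pi * (k * (q * p + r))%:R / p%:R
        = 2 * pi * (k * r)%:R / p%:R + 2 * pi * (k * q)%:R :> R.
  rewrite mulnDr mulnA natrD [(k * q * p)%:R]natrM.
  move: (2 * pi : R) => c.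
  by rewrite mulrDr mulrDl addrC [c * (_ * _)]mulrA mulfK.
by rewrite expi2n.
Qed.

Lemma paley_phi_eigen (R : realType) (p k : nat) : prime p ->
  exists mu : R[i], forall a : 'F_p,
    paley_laplacian (@paley_phi R p k) a = mu * paley_phi R k a.
Proof.
move=> p_pr; exists (\sum_(d | quad_res d) (1 - @paley_phi R p k (- d))) => a.
rewrite /paley_laplacian /paley_edge mulr_suml.
rewrite (reindex_inj (inv_inj (subKr a))) /=.
apply: eq_big => [d|d _]; first by rewrite subKr.
by rewrite mulrBl mul1r [_ * paley_phi R k a]mulrC -paley_phiD.
Qed.

(* Main.v *)
Require Import Defs.
From mathcomp Require Import all_boot all_order all_algebra.
From mathcomp Require Import all_solvable all_field.
From mathcomp Require Import reals trigo complex.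
From mathcomp Require Import ring lra.
Import Order.TTheory GRing.Theory Num.Theory.
Local Open Scope ring_scope.
Local Open Scope complex_scope.

(** Each [paley_phi k] has sup norm 1 and equals [x |-> psi (k * x)], where
    [psi] is [paley_phi 1], a nontrivial additive character of the field.  With
    [a], [b], [c] the weights [1 / sqrt lambda] of the constant, of the residues
    and of the nonresidues, the sum at [x] is therefore
      [a + b * (sum of psi (k * x) over the residues k)
         + c * (sum of psi (k * x) over the nonresidues k)].
    Every nonzero square has exactly two square roots, so both inner sums are
    affine functions of the quadratic Gauss sum
      [T x = \sum_y psi (x * y ^+ 2)],
    once the sum of [psi (x * k)] over all [k] is known; the latter is [p] at
    [x = 0] and [0] elsewhere by orthogonality.

    It remains to find [T].  Substituting [y |-> s * y] shows that [T x = T 1] for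
    a residue [x = s ^+ 2]; and since a nonresidue [x] multiplies residues to
    nonresidues, [T x + T 1 = 0] for such [x].  Finally [T 1 ^+ 2 = p]: because
    [p = 1 mod 4] there is [i] with [i ^+ 2 = -1], so [T 1 ^+ 2] is the sum of
    [psi (u ^+ 2 - v ^+ 2)], where a shift of [u] by [v] makes the argument linear
    in [v] and orthogonality applies ([quad_gauss_sum_sqr]).  Hence
    [T 1 = t] is real with [t ^+ 2 = p], the three values are real numbers, and
    they are pairwise distinct because [c < b] and [`|t| < p]
    ([three_values_distinct]).  Determining the sign of [t] is
    avoided: changing it only swaps the values at residues and at nonresidues. *)

(** * Additive characters and quadratic Gauss sums over a finite field *)

Section AdditiveCharacter.

Variables (F : finFieldType) (C : fieldType) (psi : F -> C).
Hypothesis psiD : forall x y, psi (x + y) = psi x * psi y.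
Variable g : F.
Hypothesis psi_g : psi g != 1.

(** Translating the summation variable by [g] multiplies the sum by
    [psi g != 1]. *)
Lemma addchar_sum0 : \sum_x psi x = 0.
Proof.
have shift : psi g * (\sum_x psi x) = \sum_x psi x.
  rewrite [RHS](reindex_inj (addrI g)) mulr_sumr.
  by apply: eq_bigr => x _; rewrite psiD.
apply/eqP; move/eqP: shift.
by rewrite -subr_eq0 -{2}[\sum_x _]mul1r -mulrBl mulf_eq0 subr_eq0 (negPf psi_g).
Qed.

Hypothesis psi0 : psi 0 = 1.

Lemma addchar_orthogonality a :
  \sum_x psi (a * x) = if a == 0 then #|F|%:R else 0.
Proof.
have [->|an0] /= := eqVneq a 0.
  by under eq_bigr do rewrite mul0r psi0; rewrite sumr_const.
by rewrite -[RHS]addchar_sum0 [RHS](reindex_inj (mulfI an0)).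
Qed.

(** As [-1 = i ^+ 2], one factor can be written with [- v ^+ 2] in place of
    [v ^+ 2].  Replacing [u] by [u + v] turns [u ^+ 2 - v ^+ 2] into
    [u ^+ 2 + 2 u v], linear in [v]; summing over [v] first, orthogonality kills
    every term except [u = 0].  The common factor [a] only rescales the argument. *)
Lemma quad_gauss_sum_sqr (i a : F) :
    i ^+ 2 = -1 -> 2%:R != 0 :> F -> a != 0 ->
  (\sum_y psi (a * y ^+ 2)) ^+ 2 = #|F|%:R.
Proof.
move=> i2 two0 an0.
have in0 : i != 0.
  by apply: contra_eq_neq i2 => ->; rewrite expr0n eq_sym oppr_eq0 oner_eq0.
have sum_i : \sum_y psi (a * y ^+ 2) = \sum_y psi (a * (i * y) ^+ 2).
  by rewrite [LHS](reindex_inj (mulfI in0)).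
rewrite expr2 {2}sum_i mulr_suml.
transitivity (\sum_(u : F) psi (a * u ^+ 2) * \sum_(v : F) psi (2%:R * a * u * v)).
  under eq_bigr do rewrite mulr_sumr.
  rewrite exchange_big /=; under [RHS]eq_bigr do rewrite mulr_sumr.
  rewrite [RHS]exchange_big /=; apply: eq_bigr => v _.
  rewrite (reindex_inj (addIr v)); apply: eq_bigr => u _.
  by rewrite -!psiD exprMn i2; congr psi; ring.
under eq_bigr do rewrite addchar_orthogonality.
rewrite (bigD1 0) //= big1 => [|u un0].
  by rewrite expr0n !mulr0 psi0 eqxx mul1r addr0.
by rewrite !mulf_eq0 (negPf two0) (negPf an0) (negPf un0) mulr0.
Qed.

End AdditiveCharacter.

(** * Quadratic residues modulo an odd prime *)

Section Residues.

Variables (p : nat) (p_pr : prime p) (p_odd : odd p).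

Lemma quad_res_sqr (y : 'F_p) : y != 0 -> quad_res (y ^+ 2).
Proof. by move=> yn0; apply/existsP; exists y; rewrite yn0 eqxx. Qed.

Lemma quad_res_neq0 (a : 'F_p) : quad_res a -> a != 0.
Proof. by case/existsP=> y /andP[yn0 /eqP->]; rewrite expf_neq0. Qed.

Lemma Fp_two_neq0 : 2%:R != 0 :> 'F_p.
Proof.
rewrite -(dvdn_pcharf (pchar_Fp p_pr)) dvdn_prime2 //.
by apply: contraTneq p_odd => ->.
Qed.

Lemma sum_sqr_Fp (V : zmodType) (f : 'F_p -> V) :
  \sum_y f (y ^+ 2) = f 0 + (\sum_(k | quad_res k) f k) *+ 2.
Proof.
rewrite (bigD1 0) //= expr0n /=; congr (_ + _).
rewrite (partition_big (fun y => y ^+ 2) (@quad_res p)) /=; last exact: quad_res_sqr.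
rewrite -sumrMnl; apply: eq_bigr => _ /existsP[s /andP[sn0 /eqP ->]].
rewrite (eq_bigr (fun _ => f (s ^+ 2))) => [|y /andP[_ /eqP-> //]].
rewrite sumr_const; congr (_ *+ _).
have sNs : s != - s.
  by rewrite -addr_eq0 -mulr2n -mulr_natr mulf_neq0 ?Fp_two_neq0.
(* The fibre of squaring above s ^+ 2 is {s, - s}. *)
rewrite -[RHS](_ : #|[set s; - s]| = 2%N); last by rewrite cards2 sNs.
apply: eq_card => y; rewrite !inE unfold_in eqf_sqr.
have [->|//] := eqVneq y 0.
by rewrite eq_sym (negPf sn0) eq_sym oppr_eq0 (negPf sn0).
Qed.

(** This is [sum_sqr_Fp] for the constant function 1. *)
Lemma card_quad_res : p = (#|[set k : 'F_p | quad_res k]|.*2).+1.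
Proof.
have := @sum_sqr_Fp int (fun _ => 1).
rewrite !sumr_const -[X in X *+ #|_|]/(1 : int) card_Fp // => /eqP.
rewrite -mulrnA -mulrS eqr_nat muln2 => /eqP {1}->.
by rewrite cardsE.
Qed.

Lemma card_quad_nonres : #|[set k : 'F_p | quad_nonres k]| = #|[set k : 'F_p | quad_res k]|.
Proof.
have D : [set k : 'F_p | quad_nonres k] = [set~ 0] :\: [set k : 'F_p | quad_res k].
  by apply/setP=> k; rewrite !inE andbC.
have S : [set k : 'F_p | quad_res k] \subset [set~ 0].
  by apply/subsetP=> k; rewrite !inE => /quad_res_neq0.
rewrite D cardsD (setIidPr S) cardsC1 card_Fp // {1}card_quad_res /=.
by rewrite -addnn addnK.
Qed.

Lemma quad_resM (a b : 'F_p) : quad_res a -> quad_res (a * b) = quad_res b.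
Proof.
move=> /existsP[s /andP[sn0 /eqP->]].
apply/existsP/existsP => -[y /andP[yn0 /eqP e]]; last first.
  by exists (s * y); rewrite mulf_neq0 //= e exprMn.
exists (s^-1 * y); rewrite mulf_neq0 ?invr_neq0 //= exprMn -e mulrA -exprMn.
by rewrite mulVf // expr1n mul1r.
Qed.

(** The product of a nonresidue and a residue is a nonresidue; multiplication
    by [x] is injective and the two classes have the same size, so it is onto. *)
Lemma quad_nonres_imset (x : 'F_p) : quad_nonres x ->
  [set x * k | k in [set k : 'F_p | quad_res k]] = [set k : 'F_p | quad_nonres k].
Proof.
move=> /andP[xn0 xN]; apply/eqP; rewrite eqEcard card_quad_nonres.
rewrite card_imset ?leqnn ?andbT; last exact: mulfI.
apply/subsetP => _ /imsetP[k kR ->]; move: kR; rewrite !inE => kR.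
by rewrite /quad_nonres mulf_neq0 ?(quad_res_neq0 k) //= mulrC quad_resM.
Qed.

Lemma sum_Fp_trichotomy (V : zmodType) (f : 'F_p -> V) :
  \sum_k f k = f 0 + (\sum_(k | quad_res k) f k + \sum_(k | quad_nonres k) f k).
Proof.
rewrite (bigD1 0) //= (bigID (@quad_res p)) /=; congr (_ + (_ + _)).
by apply: eq_bigl => k; apply: andb_idl => /quad_res_neq0.
Qed.

Lemma sum_sqr_res (V : zmodType) (f : 'F_p -> V) (x : 'F_p) : quad_res x ->
  \sum_y f (x * y ^+ 2) = \sum_y f (y ^+ 2).
Proof.
move=> /existsP[s /andP[sn0 /eqP->]].
rewrite [RHS](reindex_inj (mulfI sn0)).
by apply: eq_bigr => y _; rewrite exprMn.
Qed.

(** As [y] runs over the field, [y ^+ 2] covers 0 once and each residue twice,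
    while [x * y ^+ 2] covers 0 once and each nonresidue twice. *)
Lemma sum_sqr_nonres (V : zmodType) (f : 'F_p -> V) (x : 'F_p) : quad_nonres x ->
  \sum_y f (x * y ^+ 2) + \sum_y f (y ^+ 2) = (\sum_k f k) *+ 2.
Proof.
move=> xN; rewrite (sum_sqr_Fp _ (fun k => f (x * k))) sum_sqr_Fp mulr0.
have -> : \sum_(k | quad_res k) f (x * k) = \sum_(k | quad_nonres k) f k.
  rewrite -[RHS]big_set -(quad_nonres_imset x xN) big_imset /=; last first.
    by move=> k l _ _; apply: mulfI; case/andP: xN.
  by rewrite big_set.
by rewrite sum_Fp_trichotomy !mulrnDl addrACA -mulr2n [X in _ + X = _]addrC.
Qed.

End Residues.

(** If [z] is a generator of the multiplicative group, [z ^+ ((p - 1) / 4)] has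
    order 4, so its square is a square root of 1 other than 1. *)
Lemma Fp_sqrtN1 (p : nat) : prime p -> p = 1 %[mod 4] ->
  exists i : 'F_p, i ^+ 2 = -1.
Proof.
move=> p_pr p4.
have p1 : (0 < p.-1)%N by rewrite -subn1 subn_gt0 prime_gt1.
have d4 : (4 %| p.-1)%N.
  by rewrite -subn1 -eqn_mod_dvd ?prime_gt0 //; apply/eqP.
have : has p.-1.-primitive_root (enum (predC1 (0 : 'F_p))).
  apply: has_prim_root => //.
  - apply/allP => x; rewrite mem_enum => xn0.
    apply/unity_rootP; apply: (mulfI xn0).
    by rewrite -exprS prednK ?prime_gt0 // mulr1 -[in X in _ ^+ X](card_Fp p_pr) expf_card.
  - exact: enum_uniq.
  - by rewrite -[in X in (X <= _)%N](card_Fp p_pr) -(cardC1 (0 : 'F_p)) -cardE.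
case/hasP => z _ zP.
exists (z ^+ (p.-1 %/ 4)).
have [m em] := dvdnP d4.
have m0 : (0 < m)%N by move: p1; rewrite em; case: m {em}.
rewrite em mulnK //.
have : (z ^+ m ^+ 2) ^+ 2 = 1 ^+ 2.
  by rewrite -!exprM -[(2 * 2)%N]/4%N -em expr1n prim_expr_order.
move/eqP; rewrite eqf_sqr => /orP[|/eqP//].
rewrite -exprM -(prim_order_dvd zP) em dvdn_pmul2l //.
Qed.

(** * The Paley sum in terms of the Gauss sum *)

Section PaleySum.

Variables (R : realType) (p : nat) (p_pr : prime p).

Let psi : 'F_p -> R[i] := paley_phi R 1.

Lemma expi0 : expi (0 : R) = 1.
Proof. by rewrite /expi cos0 sin0. Qed.

Lemma normc_expi (t : R) : ComplexField.Normc.normc (expi t) = 1.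
Proof. by rewrite /= cos2Dsin2 sqrtr1. Qed.

Lemma paley_phi0 (k : nat) : paley_phi R k (0 : 'F_p) = 1.
Proof. by rewrite /paley_phi muln0 mulr0 mul0r expi0. Qed.

(** Both sides are the [k]-th power of [paley_phi R 1 x]; on the right this
    absorbs the reduction modulo [p] of [k * x]. *)
Lemma paley_phi_character (k : nat) (x : 'F_p) :
  paley_phi R k x = paley_phi R 1 (k%:R * x).
Proof.
have -> : paley_phi R k x = paley_phi R 1 x ^+ k.
  elim: k => [|k IH].
    by rewrite /paley_phi mul0n mulr0 mul0r expi0.
  rewrite exprS -IH /paley_phi -expiD; congr expi.
  by rewrite -mulrDl -mulrDr -natrD mulSn mul1n.
elim: k => [|k IH]; first by rewrite mul0r paley_phi0.
by rewrite -natr1 mulrDl mul1r paley_phiD // -IH exprSr.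
Qed.

(** Since [p > 2], the angle [2 pi / p] lies strictly between 0 and [pi], so its
    sine is nonzero. *)
Lemma paley_phi1_neq1 : odd p -> paley_phi R 1 (1 : 'F_p) != 1.
Proof.
move=> p_odd; rewrite /paley_phi.
have p_gt2 : (2 < p)%N by rewrite ltn_neqAle prime_gt1 // andbT; case: eqP p_odd => // <-.
have p0 : 0 < p%:R :> R by rewrite ltr0n prime_gt0.
apply/eqP => /(congr1 (@complex.Im R)) /= /eqP; rewrite gt_eqF //.
rewrite muln1 mulr1; apply: sin_gt0_pi.
rewrite divr_gt0 ?mulr_gt0 ?pi_gt0 //= ltr_pdivrMr // mulrC ltr_pM2l ?pi_gt0 //.
by rewrite ltr_nat.
Qed.

Lemma sup_norm_paley_phi (k : nat) : sup_norm (@paley_phi R p k) = 1.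
Proof.
rewrite /sup_norm; under eq_bigr do rewrite normc_expi.
rewrite (bigD1 0) //=; apply/max_idPl.
by elim/big_ind: _ => // a b a1 b1; rewrite ge_max a1.
Qed.

Lemma paley_sum_split (x : 'F_p) :
  paley_sum R x =
    (Num.sqrt ((p%:R - 1) / 2))^-1%:C
    + (Num.sqrt ((p%:R - Num.sqrt p%:R) / 2))^-1%:C
        * (\sum_(k | quad_res k) psi (k * x))
    + (Num.sqrt ((p%:R + Num.sqrt p%:R) / 2))^-1%:C
        * (\sum_(k | quad_nonres k) psi (k * x)).
Proof.
pose w (k : nat) := (Num.sqrt (paley_lambda R p k))^-1%:C.
have -> : paley_sum R x = \sum_(k : 'F_p) w k * psi (k * x).
  rewrite /paley_sum -(big_mkord predT (fun k => w k * (paley_phi R k x / (sup_norm (@paley_phi R p k))%:C))).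
  rewrite -{1}(Fp_cast p_pr) big_mkord; apply: eq_bigr => k _.
  by rewrite sup_norm_paley_phi divr1 paley_phi_character natr_Zp.
rewrite sum_Fp_trichotomy // mul0r /psi paley_phi0 mulr1 addrA !mulr_sumr.
congr (_ + _ + _); apply: eq_bigr => k.
- by move=> kR; rewrite /w /paley_lambda natr_Zp kR ifN //; apply: (quad_res_neq0 p).
- by case/andP => kn0 kN; rewrite /w /paley_lambda natr_Zp (negPf kN) ifN.
Qed.

(** With [r] and [n] the sums of [psi (x * k)] over residues and nonresidues,
    the two sums on the right are [1 + 2 r] and [1 + r + n].  Leaving the
    complete sum over [k] unevaluated covers [x = 0] and [x != 0] at once. *)
Lemma paley_sum_gauss (x : 'F_p) : odd p ->
  paley_sum R x =
    (Num.sqrt ((p%:R - 1) / 2))^-1%:C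
    + (Num.sqrt ((p%:R - Num.sqrt p%:R) / 2))^-1%:C
        * ((\sum_y psi (x * y ^+ 2) - 1) / 2)
    + (Num.sqrt ((p%:R + Num.sqrt p%:R) / 2))^-1%:C
        * (\sum_k psi (x * k) - (\sum_y psi (x * y ^+ 2) + 1) / 2).
Proof.
move=> p_odd; rewrite paley_sum_split.
rewrite (sum_sqr_Fp p p_pr p_odd _ (fun k => psi (x * k))) sum_Fp_trichotomy //.
have -> : psi (x * 0) = 1 by rewrite mulr0; apply: paley_phi0.
under eq_bigr do rewrite mulrC.
under [\sum_(k | quad_nonres k) psi (k * x)]eq_bigr do rewrite mulrC.
rewrite -[(\sum_(k | quad_res k) _) *+ 2]mulr_natr.
by congr (_ + _ * _ + _ * _); field.
Qed.

End PaleySum.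

(** * Separation of the three values *)

(** Here [v0 - v u = (b * (q - u) + c * (q + u)) / 2], positive for [`|u| < q],
    and [v t - v (- t) = (b - c) * t]. *)
Lemma three_values_distinct (R : realFieldType) (a b c q t : R) :
    0 < c -> c < b -> 1 < q -> t ^+ 2 = q ->
  let v0 := a + b * ((q - 1) / 2) + c * (q - (q + 1) / 2) in
  let v u := a + b * ((u - 1) / 2) + c * (0 - (u + 1) / 2) in
  [/\ v0 != v t, v0 != v (- t) & v t != v (- t)].
Proof.
move=> c0 cb q1 tq v0 v.
have tn0 : t != 0 by apply: contraTneq q1 => t0; rewrite -tq t0 expr0n ltr10.
have t_lt_q : `|t| < q.
  rewrite -(ltr_pXn2r (n := 2)) ?nnegrE ?normr_ge0 // ?(ltW (lt_trans _ q1)) //.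
  by rewrite real_normK ?num_real // tq -[ltLHS]mulr1 expr2 ltr_pM2l // (lt_trans _ q1).
move: t_lt_q; rewrite ltr_norml => /andP[qt tq'].
have pos u : - q < u -> u < q -> v0 != v u.
  move=> uq1 uq2; rewrite gt_eqF // -subr_gt0.
  have -> : v0 - v u = (b * (q - u) + c * (q + u)) / 2 by rewrite /v0 /v; field.
  by rewrite divr_gt0 // addr_gt0 // mulr_gt0 //; lra.
split; [by apply: pos | by apply: pos; lra |].
rewrite -subr_eq0; have -> : v t - v (- t) = (b - c) * t by rewrite /v; field.
by rewrite mulf_neq0 // subr_eq0 gt_eqF.
Qed.

Theorem theorem2 (R : realType) (p : nat) (p_pr : prime p)
    (p_mod4 : p = 1 %[mod 4]) :
  exists v0 vr vn : R[i],
    [/\ v0 != vr, v0 != vn & vr != vn] /\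
    (forall v : R[i], (exists x : 'F_p, paley_sum R x = v) <->
                      [\/ v = v0, v = vr | v = vn]) /\
    (forall x : 'F_p,
       [/\ x = 0 -> paley_sum R x = v0,
           quad_res x -> paley_sum R x = vr
         & quad_nonres x -> paley_sum R x = vn]).
Proof.
have p_odd : odd p.
  by rewrite (divn_eq p 4) p_mod4 oddD oddM andbF.
pose psi : 'F_p -> R[i] := paley_phi R 1.
have psiD : forall x y, psi (x + y) = psi x * psi y.
  by move=> x y; apply: paley_phiD.
have psi1 : psi 1 != 1 by apply: paley_phi1_neq1.
have psi0 : psi 0 = 1 by apply: paley_phi0.
have orth x := addchar_orthogonality 'F_p R[i] psi psiD 1 psi1 psi0 x.
pose T (x : 'F_p) := \sum_y psi (x * y ^+ 2).
have [i i2] := Fp_sqrtN1 p p_pr p_mod4.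
have T1_sqr : T 1 ^+ 2 = p%:R.
  rewrite /T (quad_gauss_sum_sqr 'F_p R[i] psi psiD 1 psi1 psi0 i) ?oner_neq0 ?card_Fp //.
  exact: Fp_two_neq0.
have p_gt1 : 1 < p%:R :> R by rewrite ltr1n prime_gt1.
have p_ge0 : 0 <= p%:R :> R by exact: ler0n.
(* The square root of T 1 ^+ 2 is real, but its sign is left undetermined. *)
have [t T1t tp] : exists2 t : R, T 1 = t%:C & t ^+ 2 = p%:R.
  have : T 1 ^+ 2 = (Num.sqrt p%:R)%:C ^+ 2.
    by rewrite T1_sqr -rmorphXn /= sqr_sqrtr // rmorph_nat.
  move/eqP; rewrite eqf_sqr => /orP[] /eqP ->.
    by exists (Num.sqrt p%:R); rewrite ?sqr_sqrtr.
  by exists (- Num.sqrt p%:R); rewrite ?rmorphN // sqrrN sqr_sqrtr.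
have TR (x : 'F_p) : quad_res x -> T x = t%:C.
  move=> xR; rewrite -T1t /T (sum_sqr_res p _ psi) //.
  by apply: eq_bigr => y _; rewrite mul1r.
have TN (x : 'F_p) : quad_nonres x -> T x = (- t)%:C.
  move=> xN; have := sum_sqr_nonres p p_pr p_odd _ psi x xN.
  under [\sum_k psi k]eq_bigr do rewrite -[X in psi X]mul1r.
  rewrite orth oner_eq0 mul0rn -(sum_sqr_res p _ psi 1); last first.
    by rewrite -(expr1n _ 2) quad_res_sqr ?oner_neq0.
  by rewrite -/(T x) -/(T 1) T1t => /eqP; rewrite addr_eq0 rmorphN => /eqP.
pose a : R := (Num.sqrt ((p%:R - 1) / 2))^-1.
pose b : R := (Num.sqrt ((p%:R - Num.sqrt p%:R) / 2))^-1.
pose c : R := (Num.sqrt ((p%:R + Num.sqrt p%:R) / 2))^-1.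
have s0 : 0 < Num.sqrt p%:R :> R by rewrite sqrtr_gt0 (lt_trans _ p_gt1).
have sp : Num.sqrt p%:R < p%:R :> R.
  rewrite -[ltRHS]sqr_sqrtr // -[ltLHS]mulr1 expr2 ltr_pM2l //.
  by rewrite -[ltLHS]sqrtr1 ltr_sqrt // (lt_trans _ p_gt1).
have c0 : 0 < c by rewrite invr_gt0 sqrtr_gt0; lra.
have cb : c < b.
  by rewrite ltf_pV2 ?posrE ?sqrtr_gt0 ?ltr_sqrt; lra.
pose v0 := a + b * ((p%:R - 1) / 2) + c * (p%:R - (p%:R + 1) / 2).
pose v u := a + b * ((u - 1) / 2) + c * (0 - (u + 1) / 2).
have S0 : paley_sum R (0 : 'F_p) = v0%:C.
  have sum0 (f : 'F_p -> 'F_p) : \sum_y psi (0 * f y) = p%:R.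
    by under eq_bigr do rewrite mul0r psi0; rewrite sumr_const card_Fp.
  rewrite paley_sum_gauss // (sum0 (fun y => y ^+ 2)) ?(sum0 id).
  by rewrite /v0 !(rmorphD, rmorphM, rmorphN, fmorphV, rmorph1, rmorph_nat).
have SV (x : 'F_p) (u : R) : x != 0 -> T x = u%:C -> paley_sum R x = (v u)%:C.
  move=> xn0 Txu; rewrite paley_sum_gauss // orth (negPf xn0) -/(T x) Txu.
  by rewrite /v !(rmorphD, rmorphM, rmorphN, fmorphV, rmorph1, rmorph0, rmorph_nat).
have SR (x : 'F_p) : quad_res x -> paley_sum R x = (v t)%:C.
  by move=> xR; apply: (SV x t); [apply: (quad_res_neq0 p) | apply: TR].
have SN (x : 'F_p) : quad_nonres x -> paley_sum R x = (v (- t))%:C.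
  by move=> xN; apply: (SV x (- t)); [case/andP: xN | apply: TN].
have [d1 d2 d3] := three_values_distinct R a b c p%:R t c0 cb p_gt1 tp.
exists v0%:C, (v t)%:C, (v (- t))%:C; split; last split.
- by split; rewrite (inj_eq (@complexI R)).
- move=> w; split.
    move=> [x <-]; have [->|xn0] := eqVneq x 0; first by constructor 1.
    have [xR|xN] := boolP (quad_res x); first by constructor 2; apply: SR.
    by constructor 3; apply: SN; rewrite /quad_nonres xn0.
  case=> ->; first by exists 0.
    by exists 1; apply: SR; rewrite -(expr1n _ 2) quad_res_sqr ?oner_neq0.
  (* There are as many nonresidues as residues, namely (p - 1) / 2 > 0. *)
  have : (0 < #|[set k : 'F_p | quad_nonres k]|)%N.
    rewrite card_quad_nonres // -double_gt0 -ltnS -card_quad_res //.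
    exact: prime_gt1.
  by case/card_gt0P => x; rewrite inE => xN; exists x; apply: SN.
- move=> x; split; [by move=> -> | exact: SR | exact: SN].
Qed.
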